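(* Let $f,p,q\in C^2([a,b],\mathbb{C})$ and let $f$ be a solution of the differential equation $f''+pf'+qf=0$. Then $$w:=\det\begin{pmatrix} f'' & f' & f\\ f''' & f'' & f'\\ f^{(4)} & f''' & f''\end{pmatrix}=\left(p'f'+q'f\right)^2f-A\cdot v,$$ where $v=f'f'-f''f$ and $A$ is given by the equivalent formulae $$A=2p'f''+\left(p''+p'p+2q'\right)f'+\left(q''+pq'\right)f,$$ $$A=\left(p''-p'p+2q'\right)f'+\left(-2p'q+q''+pq'\right)f.$$
   Context: Primes and superscripts $(k)$ denote derivatives with respect to the real variable $x\in[a,b]$. *)

(* Defs.v *)
From HB Require Import structures.
From mathcomp Require Export all_boot all_order all_algebra.
From mathcomp Require Export all_classical all_reals all_analysis.
From mathcomp Require Export complex.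

Set Implicit Arguments.
Unset Strict Implicit.
Unset Printing Implicit Defensive.

Export Order.TTheory GRing.Theory Num.Theory.
Export numFieldNormedType.Exports.

Local Open Scope classical_set_scope.
Local Open Scope ring_scope.
Local Open Scope complex_scope.

(* The topology of R[i] is the one induced by its modulus; R[i] carries no
   topology by default, only its regular module R[i]^o does. *)
HB.instance Definition _ (R : rcfType) := NormedModule.copy R[i] R[i]^o.

Section DerivativeOnSegment.
Variables (R : realType) (a b : R).
Implicit Types (g : R -> R[i]) (n : nat) (x : R).

(* Limits of difference quotients are taken inside [a, b], so that they are
   one-sided at a and b and do not depend on the values of g outside [a, b]. *)
Definition diff_quotient g x : R -> R[i] :=
  fun y => (g y - g x) / (y - x)%:C.

Definition derivable_on g x : Prop :=
  cvg (diff_quotient g x y @[y --> within `[a, b] x^']).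

(* Meaningful when a < b, x is in [a, b] and derivable_on g x holds. *)
Definition derive_on g : R -> R[i] :=
  fun x => lim (diff_quotient g x y @[y --> within `[a, b] x^']).

Definition derivable_on_n n g : Prop :=
  forall k, (k < n)%N ->
  {in `[a, b], forall x, derivable_on (iter k derive_on g) x}.

Definition Cn_on n g : Prop :=
  derivable_on_n n g /\
  forall k, (k <= n)%N -> {within `[a, b], continuous (iter k derive_on g)}.

End DerivativeOnSegment.

(* Main.v *)
(* The equation f'' = -(p f' + q f) lets f'' inherit two derivatives from f',
   f, p, q by the product rule.  Substituting the resulting f''' and f'''',
   both identities become polynomial in f, f', p, q and their derivatives:
   adding p times the second and q times the third column to the first one
   turns that column into (0, -(p'f' + q'f), -(p''f' + 2p'f'' + q''f + 2q'f')),
   and expanding along it gives the formula. *)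
Require Import Defs.
From mathcomp Require Import ring lra.

Local Open Scope classical_set_scope.
Local Open Scope ring_scope.
Local Open Scope complex_scope.

(* R[i] carries several convertible normed structures, between which unification
   gets lost; hence these limit rules with the structure fixed. *)
Section ComplexLimits.
Context {R : realType} {T : Type} {F : set_system T} {FF : Filter F}.
Context {f g : T -> R[i]} {l m : R[i]}.

Lemma cvgD_complex : f @ F --> l -> g @ F --> m ->
  (fun x => f x + g x) @ F --> l + m.
Proof. by move=> fl gm; exact: (@cvgD R[i] R[i] _ _ _ _ _ _ _ fl gm). Qed.

Lemma cvgN_complex : f @ F --> l -> (fun x => - f x) @ F --> - l.
Proof. by move=> fl; exact: (@cvgN R[i] R[i] _ _ _ _ _ fl). Qed.

Lemma cvgM_complex : f @ F --> l -> g @ F --> m ->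
  (fun x => f x * g x) @ F --> l * m.
Proof. by move=> fl gm; exact: (@cvgM R[i] _ _ _ _ _ _ _ fl gm). Qed.

End ComplexLimits.

Section HasDeriveOn.
Context {R : realType} {a b : R}.
Implicit Types (g h : R -> R[i]) (x : R) (l m : R[i]).

(** A relation carrying existence and value together, so that the rules below compose without
    handling [lim], which is arbitrary when there is no limit. *)
Definition has_derive_on g x l : Prop :=
  diff_quotient g x y @[y --> within `[a, b] x^'] --> l.

(** Makes limits along this filter unique. Every ball around [x] meets the segment on the right of
    [x] if [x < b]; otherwise [x = b], and [a < b] leaves room on the left. *)
Lemma within_itv_dnbhs_proper {x} : a < b -> x \in `[a, b] ->
  ProperFilter (within `[a, b] x^').
Proof.
move=> ab; rewrite in_itv/= => /andP[ax xb]; apply: Build_ProperFilter => //.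
rewrite /within /dnbhs /within /= => /nbhs_ballP[e /= e0 xe].
have [xltb|bx] := ltP x b.
- set d := Num.min (e / 2) (b - x).
  have d0 : 0 < d by rewrite lt_min; apply/andP; split; lra.
  have [de db] : d <= e / 2 /\ d <= b - x by rewrite !ge_min !lexx orbT.
  apply: (xe (x + d)).
  + by rewrite /ball/= opprD addNKr normrN gtr0_norm//; lra.
  + by rewrite gt_eqF// ltrDl.
  + by rewrite in_itv/=; lra.
- set d := Num.min (e / 2) (x - a).
  have d0 : 0 < d by rewrite lt_min; apply/andP; split; lra.
  have [de da] : d <= e / 2 /\ d <= x - a by rewrite !ge_min !lexx orbT.
  apply: (xe (x - d)).
  + by rewrite /ball/= opprB addrC subrK gtr0_norm//; lra.
  + by rewrite lt_eqF// ltrBlDr ltrDl.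
  + by rewrite in_itv/=; lra.
Qed.

Lemma derive_on_val {g x l} : a < b -> x \in `[a, b] -> has_derive_on g x l ->
  derive_on a b g x = l.
Proof.
move=> ab xab; have := within_itv_dnbhs_proper ab xab => ?.
by move/cvg_lim; apply; exact: norm_hausdorff.
Qed.

Lemma has_derive_onD {g h x l m} :
  has_derive_on g x l -> has_derive_on h x m ->
  has_derive_on (fun y => g y + h y) x (l + m).
Proof.
move=> gl hm; rewrite /has_derive_on.
rewrite (_ : diff_quotient _ x =
    fun y => diff_quotient g x y + diff_quotient h x y).
  exact: cvgD_complex gl hm.
by apply/funext => y; rewrite /diff_quotient; ring.
Qed.

Lemma has_derive_onN {g x l} :
  has_derive_on g x l -> has_derive_on (fun y => - g y) x (- l).
Proof.
move=> gl; rewrite /has_derive_on.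
rewrite (_ : diff_quotient _ x = fun y => - diff_quotient g x y).
  exact: cvgN_complex gl.
by apply/funext => y; rewrite /diff_quotient; ring.
Qed.

Lemma cvg_real_complex_sub0 x :
  (y - x)%:C @[y --> within `[a, b] x^'] --> (0 : R[i]).
Proof.
apply/cvgr0Pnorm_lt => e e0.
(* The radius [e] is complex, but [0 < e] in [R[i]] forces its imaginary part to vanish. *)
have [r r0 ->] : exists2 r : R, 0 < r & e = r%:C.
  exists (complex.Re e); first by move: e0; rewrite ltcE => /andP[].
  by rewrite RRe_real// gtr0_real.
rewrite !near_withinE; near=> y => _ _.
rewrite normc_def /= expr0n addr0 sqrtr_sqr ltcR distrC.
by near: y; exact: nbhsx_ballx.
Unshelve. all: by end_near. Qed.

Lemma has_derive_on_continuous {g x l} :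
  has_derive_on g x l -> g y @[y --> within `[a, b] x^'] --> g x.
Proof.
move=> gl.
have gx : diff_quotient g x y * (y - x)%:C + g x @[y --> within `[a, b] x^']
    --> l * 0 + g x.
  apply: cvgD_complex (cvgM_complex gl (cvg_real_complex_sub0 x)) _.
  exact: cvg_cst.
rewrite mulr0 add0r in gx; apply: (cvg_trans _ gx); apply: near_eq_cvg.
(* The filter is punctured, so [y != x] and the denominator [y - x] cancels. *)
rewrite !near_withinE; near=> y => yx _.
by rewrite /diff_quotient divfK ?subrK// fmorph_eq0 subr_eq0.
Unshelve. all: by end_near. Qed.

Lemma has_derive_onM {g h x l m} :
  has_derive_on g x l -> has_derive_on h x m ->
  has_derive_on (fun y => g y * h y) x (l * h x + g x * m).
Proof.
move=> gl hm; rewrite /has_derive_on.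
(* One factor is kept at [y] and the other at [x]; continuity of [h] along the filter handles
   [h y]. *)
rewrite (_ : diff_quotient _ x =
    fun y => diff_quotient g x y * h y + g x * diff_quotient h x y).
  apply: cvgD_complex (cvgM_complex gl (has_derive_on_continuous hm)) _.
  by apply: cvgM_complex hm; exact: cvg_cst.
by apply/funext => y; rewrite /diff_quotient; ring.
Qed.

(** Quotients are only taken inside the segment. This lets equations known only there, such as the
    differential equation, be differentiated. *)
Lemma eq_has_derive_on {g h x l} : x \in `[a, b] ->
  {in `[a, b], h =1 g} -> has_derive_on g x l -> has_derive_on h x l.
Proof.
move=> xab hg gl; apply: (cvg_trans _ gl); apply: near_eq_cvg.
rewrite near_withinE; apply: nearW => y yab.
by rewrite /diff_quotient !hg.
Qed.

End HasDeriveOn.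

Arguments has_derive_on {R} a b g x l.

Lemma det_mx33_seq (R : comNzRingType) (a b c d e f g h k : R) :
  \det (\matrix_(i < 3, j < 3)
    nth 0 (nth [::] [:: [:: a; b; c]; [:: d; e; f]; [:: g; h; k]] i) j) =
  a * (e * k - f * h) - b * (d * k - f * g) + c * (d * h - e * g).
Proof.
rewrite (expand_det_row _ ord0) !big_ord_recl big_ord0 /cofactor.
rewrite !(expand_det_row _ ord0) !big_ord_recl !big_ord0 /cofactor !det_mx11.
by rewrite !mxE /=; ring.
Qed.

Theorem theorem11 (R : realType) (a b : R) (hab : a < b)
  (f p q : R -> R[i])
  (hf : Cn_on a b 2 f) (hp : Cn_on a b 2 p) (hq : Cn_on a b 2 q) :
  let f' := derive_on a b f in
  let f'' := derive_on a b f' in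
  let f''' := derive_on a b f'' in
  let f'''' := derive_on a b f''' in
  let p' := derive_on a b p in
  let p'' := derive_on a b p' in
  let q' := derive_on a b q in
  let q'' := derive_on a b q' in
  {in `[a, b], forall x, f'' x + p x * f' x + q x * f x = 0} ->
  derivable_on_n a b 4 f /\
  {in `[a, b], forall x,
    let w := \det (\matrix_(i < 3, j < 3)
      nth 0 (nth [::]
        [:: [:: f'' x;   f' x;   f x  ];
            [:: f''' x;  f'' x;  f' x ];
            [:: f'''' x; f''' x; f'' x]] i) j) in
    let v := f' x * f' x - f'' x * f x in
    let A1 := 2 * p' x * f'' x
              + (p'' x + p' x * p x + 2 * q' x) * f' x
              + (q'' x + p x * q' x) * f x in
    let A2 := (p'' x - p' x * p x + 2 * q' x) * f' x
              + (- 2 * p' x * q x + q'' x + p x * q' x) * f x in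
    [/\ w = (p' x * f' x + q' x * f x) ^+ 2 * f x - A1 * v,
        w = (p' x * f' x + q' x * f x) ^+ 2 * f x - A2 * v
      & A1 = A2]}.
Proof.
move=> f' f'' f''' f'''' p' p'' q' q'' ode.
(* [cvg] unfolds to convergence to the [lim] that defines [derive_on]. *)
have D g n x : Cn_on a b 2 g -> x \in `[a, b] -> (n < 2)%N ->
    has_derive_on a b (iter n (derive_on a b) g) x
      (iter n.+1 (derive_on a b) g x).
  by move=> [dg _] xab n2; exact: dg.
have Df x xab : has_derive_on a b f x (f' x) := D f 0 x hf xab isT.
have Df' x xab : has_derive_on a b f' x (f'' x) := D f 1 x hf xab isT.
have Dp x xab : has_derive_on a b p x (p' x) := D p 0 x hp xab isT.
have Dp' x xab : has_derive_on a b p' x (p'' x) := D p 1 x hp xab isT.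
have Dq x xab : has_derive_on a b q x (q' x) := D q 0 x hq xab isT.
have Dq' x xab : has_derive_on a b q' x (q'' x) := D q 1 x hq xab isT.
have f''E : {in `[a, b], f'' =1 fun x => - (p x * f' x + q x * f x)}.
  by move=> x xab; apply/eqP; rewrite -addr_eq0 addrA ode.
have Df'' x (xab : x \in `[a, b]) := eq_has_derive_on xab f''E
  (has_derive_onN (has_derive_onD (has_derive_onM (Dp x xab) (Df' x xab))
                                  (has_derive_onM (Dq x xab) (Df x xab)))).
have f'''E : {in `[a, b], f''' =1 fun x =>
    - (p' x * f' x + p x * f'' x + (q' x * f x + q x * f' x))}.
  by move=> x xab; exact: derive_on_val hab xab (Df'' x xab).
(* Here the second derivatives of [p] and [q] enter. *)
have Df''' x (xab : x \in `[a, b]) := eq_has_derive_on xab f'''E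
  (has_derive_onN (has_derive_onD
    (has_derive_onD (has_derive_onM (Dp' x xab) (Df' x xab))
                    (has_derive_onM (Dp x xab) (Df'' x xab)))
    (has_derive_onD (has_derive_onM (Dq' x xab) (Df x xab))
                    (has_derive_onM (Dq x xab) (Df' x xab))))).
split=> [[|[|[|[|k]]]] k4 x xab|x xab].
- exact: cvgP (Df x xab).
- exact: cvgP (Df' x xab).
- exact: cvgP (Df'' x xab).
- exact: cvgP (Df''' x xab).
- by case: (notF k4).
have f''''E := derive_on_val hab xab (Df''' x xab).
(* Eliminating from the highest order down leaves only [f], [f'], [p], [q] and the first two
   derivatives of [p] and [q], treated as free variables by [ring]. *)
by rewrite det_mx33_seq /f'''' f''''E f'''E// f''E//; split; ring.
Qed.
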